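(* For every nonnegative integer $n$ and every integer $\alpha\ge 2$, $$\overline{A}_{5^\alpha}(25n)\equiv \overline{A}_{5^{\alpha+2}}(625n) \pmod{5}.$$
   Context: An overpartition of $n$ is a partition of $n$ in which the first occurrence of each distinct part may be overlined. For a positive integer $\ell$, $\overline{A}_\ell(n)$ denotes the number of overpartitions of $n$ into parts not divisible by $\ell$, with $\overline{A}_\ell(0)=1$; equivalently $$\sum_{n\ge 0}\overline{A}_\ell(n)q^n=\frac{(q^\ell;q^\ell)_\infty^2(q^2;q^2)_\infty}{(q;q)_\infty^2(q^{2\ell};q^{2\ell})_\infty},\qquad (a;q)_\infty=\prod_{k\ge 0}(1-aq^k).$$ *)

(* Defs.v *)
From mathcomp Require Import all_boot.

Set Implicit Arguments.
Unset Strict Implicit.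
Unset Printing Implicit Defensive.

(* A list of pairs (part, overlined?), the parts in weakly decreasing order;
   an overlined entry must be the first occurrence of its part. *)
Definition is_overpartition (n : nat) (s : seq (nat * bool)) : bool :=
  let parts := unzip1 s in
  [&& all (leq 1) parts, sorted geq parts, sumn parts == n &
      all (fun i => nth false (unzip2 s) i ==> (index (nth 0 parts i) parts == i))
          (iota 0 (size s))].

Definition forget_bound (n : nat) (s : seq ('I_n.+1 * bool)) : seq (nat * bool) :=
  [seq (nat_of_ord x.1, x.2) | x <- s].

(* An overpartition of n has at most n parts, each at most n, so the finite
   type of lists below contains each of them exactly once. *)
Definition overA (l n : nat) : nat :=
  #|[set s : n.-bseq ('I_n.+1 * bool) |
      is_overpartition n (forget_bound s)
      && all (fun k => ~~ (l %| k)) (unzip1 (forget_bound s))]|.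

Lemma forget_bound_inj (n : nat) : injective (@forget_bound n).
Proof.
apply: inj_map => -[i b] [j c] /= [ij ->].
by congr (_, _); apply: val_inj.
Qed.

Lemma overpartition_bounded (n : nat) (s : seq (nat * bool)) :
  is_overpartition n s ->
  exists t : n.-bseq ('I_n.+1 * bool), forget_bound t = s.
Proof.
case/and4P=> pos _ /eqP sumE _.
have sz : size s <= n.
  rewrite -sumE; elim: s pos {sumE} => //= -[k b] s IH /= /andP[k0 pos].
  by rewrite -add1n leq_add // IH.
have bd : all (fun x => x.1 < n.+1) s.
  rewrite -sumE; apply/allP => x xs; rewrite ltnS.
  have : x.1 \in unzip1 s by apply: map_f.
  elim: (unzip1 s) => //= k r IH; rewrite inE => /orP[/eqP->|/IH h].
    exact: leq_addr.
  exact: leq_trans h (leq_addl _ _).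
pose t : seq ('I_n.+1 * bool) := [seq (inord x.1, x.2) | x <- s].
have tsz : size t <= n by rewrite size_map.
exists (Bseq tsz); rewrite /forget_bound /= /t -map_comp.
rewrite -[RHS]map_id; apply/eq_in_map => -[k b] xs /=.
by rewrite inordK // (allP bd _ xs).
Qed.

(* Main.v *)
(* Let th = sum_k (-1)^k X^(k^2), U the extraction of every fifth coefficient, V the
   substitution X -> X^5, and G_l the generating function of overA l. By Gauss'
   identity th * prod (1 + X^k) = prod (1 - X^k), we have th * G_l = th(X^l).
   Multiplication by 2 + i and 2 - i on Gaussian integers gives
   r_2(5n) + r_2(n/5) = 2 r_2(n), that is U(th^2) = 2 th^2 - (V th)^2. Writing
   th = a + b + c with exponents in the classes 0, 1, 4 mod 5, this determines
   bc = (V th)^2 - a^2, and a = V V th; expanding (a + b + c)^k then yields, mod 5,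
   U(th^3) = V th * th^2 and U(th^4) = th^4. As th^5 = V th mod 5, it follows for
   l = 5^alpha that U G_l = V^(alpha-1) th * th^3 and
   U^2 G_l = V^(alpha-2) th * V th * th^2, and two more applications of U lead from
   l = 5^(alpha+2) to the same series. *)

From HB Require Import structures.
Require Import Defs.
From mathcomp Require Import all_boot all_order all_algebra.
From mathcomp Require Import boolp.
From mathcomp Require Import zify ring.

Set Implicit Arguments.
Unset Strict Implicit.
Unset Printing Implicit Defensive.

Import GRing.Theory.
Local Open Scope ring_scope.

(** * Formal power series *)

Definition fps (R : Type) : Type := nat -> R.

HB.instance Definition _ (R : Type) := gen_eqMixin (fps R).
HB.instance Definition _ (R : Type) := gen_choiceMixin (fps R).

Section FpsRing.
Variable R : comNzRingType.
Implicit Types f g h : fps R.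

Let zero : fps R := fun=> 0.
Let opp f : fps R := fun n => - f n.
Let add f g : fps R := fun n => f n + g n.

Fact fps_addA : associative add.
Proof. by move=> f g h; apply/funext=> n; apply: addrA. Qed.
Fact fps_addC : commutative add.
Proof. by move=> f g; apply/funext=> n; apply: addrC. Qed.
Fact fps_add0 : left_id zero add.
Proof. by move=> f; apply/funext=> n; apply: add0r. Qed.
Fact fps_addN : left_inverse zero opp add.
Proof. by move=> f; apply/funext=> n; apply: addNr. Qed.

HB.instance Definition _ :=
  GRing.isZmodule.Build (fps R) fps_addA fps_addC fps_add0 fps_addN.

Definition fps_trunc n f : {poly R} := \poly_(i < n.+1) f i.

Definition fps_mono (c : R) k : fps R := fun n => if n == k then c else 0.
#[global] Arguments fps_mono c k%_nat_scope _%_nat_scope.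

Definition fps_mul f g : fps R := fun n => \sum_(i < n.+1) f i * g (n - i)%N.

(** Coefficient n of a product only sees coefficients up to n, so the ring axioms can be borrowed
    from polynomials that agree with the series that far. *)
Lemma fps_mul_poly n (p q : {poly R}) f g :
  (forall i, (i <= n)%N -> p`_i = f i) -> (forall i, (i <= n)%N -> q`_i = g i) ->
  (p * q)`_n = fps_mul f g n.
Proof.
move=> pf qg; rewrite coefM; apply: eq_bigr => i _.
by rewrite pf ?qg ?leq_subr // -ltnS.
Qed.

Lemma coef_fps_trunc m n f : (m <= n)%N -> (fps_trunc n f)`_m = f m.
Proof. by move=> mn; rewrite coef_poly ltnS mn. Qed.

Lemma fps_mulE n f g : fps_mul f g n = (fps_trunc n f * fps_trunc n g)`_n.
Proof. by apply/esym/fps_mul_poly => i; apply: coef_fps_trunc. Qed.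

Lemma coef_trunc_mul m n f g : (m <= n)%N ->
  (fps_trunc n f * fps_trunc n g)`_m = fps_mul f g m.
Proof.
by move=> mn; apply: fps_mul_poly => i im; apply/coef_fps_trunc/(leq_trans im).
Qed.

Fact fps_mulA : associative fps_mul.
Proof.
move=> f g h; apply/funext=> n.
transitivity (fps_trunc n f * fps_trunc n g * fps_trunc n h)`_n.
  rewrite -mulrA; apply/esym/fps_mul_poly=> i i_n; first exact: coef_fps_trunc.
  exact: coef_trunc_mul.
apply: fps_mul_poly=> i i_n; first exact: coef_trunc_mul.
exact: coef_fps_trunc.
Qed.

Fact fps_mulC : commutative fps_mul.
Proof. by move=> f g; apply/funext=> n; rewrite !fps_mulE mulrC. Qed.

Lemma fps_mul_mono c k f n :
  fps_mul (fps_mono c k) f n = if (k <= n)%N then c * f (n - k)%N else 0.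
Proof.
rewrite /fps_mul /fps_mono; case: leqP => kn.
  rewrite (bigD1 (Ordinal (kn : (k < n.+1)%N))) //= eqxx big1 ?addr0 // => i.
  by rewrite -val_eqE /= => /negPf->; rewrite mul0r.
apply: big1 => i _; case: eqP => [ik|]; last by rewrite mul0r.
by have := ltn_ord i; rewrite ik ltnS leqNgt kn.
Qed.

Fact fps_mul1 : left_id (fps_mono 1 0) fps_mul.
Proof. by move=> f; apply/funext=> n; rewrite fps_mul_mono subn0 mul1r. Qed.

Fact fps_mulDl : left_distributive fps_mul +%R.
Proof.
move=> f g h; apply/funext=> n.
by rewrite /GRing.add /= /add /fps_mul -big_split; apply: eq_bigr => i _; rewrite mulrDl.
Qed.

Fact fps_1_neq0 : fps_mono 1 0 != 0 :> fps R.
Proof.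
apply/eqP => /(congr1 (fun f : fps R => f 0)) /eqP.
by rewrite /fps_mono /= oner_eq0.
Qed.

HB.instance Definition _ := GRing.Zmodule_isComNzRing.Build (fps R)
  fps_mulA fps_mulC fps_mul1 fps_mulDl fps_1_neq0.

Lemma fps_coef1 n : (1 : fps R) n = (n == 0)%:R. Proof. by case: n. Qed.
Lemma fps_coefD f g n : (f + g) n = f n + g n. Proof. by []. Qed.
Lemma fps_coefN f n : (- f) n = - f n. Proof. by []. Qed.
Lemma fps_coefM f g n : (f * g) n = \sum_(i < n.+1) f i * g (n - i)%N.
Proof. by []. Qed.
Lemma fps_coef_sum I (r : seq I) (P : pred I) (F : I -> fps R) n :
  (\sum_(i <- r | P i) F i) n = \sum_(i <- r | P i) F i n.
Proof. exact: (big_morph (fun f : fps R => f n)). Qed.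
Lemma fps_coefMn f k n : (f *+ k) n = f n *+ k.
Proof. by elim: k => // k IH; rewrite !mulrS fps_coefD IH. Qed.
Lemma fps_coefM_mono c k f n :
  (fps_mono c k * f) n = if (k <= n)%N then c * f (n - k)%N else 0.
Proof. exact: fps_mul_mono. Qed.
Lemma fps_coef0M f g : (f * g) 0%N = f 0%N * g 0%N.
Proof. by rewrite fps_coefM big_ord1. Qed.

Lemma fps_monoM c d k l : fps_mono c k * fps_mono d l = fps_mono (c * d) (k + l).
Proof.
apply/funext=> n; rewrite fps_coefM_mono /fps_mono.
case: leqP => kn; do !case: eqP => ? ; rewrite ?mulr0 //; lia.
Qed.

Lemma fps_monoX c k p : fps_mono c k ^+ p = fps_mono (c ^+ p) (k * p).
Proof.
elim: p => [|p IH]; first by rewrite muln0 !expr0.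
by rewrite !exprS IH fps_monoM mulnS.
Qed.

(** * Congruence modulo a power of the variable *)

Definition fps_eqm N f g := forall n, (n < N)%N -> f n = g n.
#[global] Arguments fps_eqm N%_nat_scope f g.

Lemma fps_eqm_refl N f : fps_eqm N f f. Proof. by []. Qed.

Lemma fps_eqm_sym N f g : fps_eqm N f g -> fps_eqm N g f.
Proof. by move=> fg n nN; rewrite fg. Qed.

Lemma fps_eqm_trans N g f h : fps_eqm N f g -> fps_eqm N g h -> fps_eqm N f h.
Proof. by move=> fg gh n nN; rewrite fg ?gh. Qed.

Lemma fps_eqm_le M N f g : (M <= N)%N -> fps_eqm N f g -> fps_eqm M f g.
Proof. by move=> MN fg n nM; apply/fg/(leq_trans nM). Qed.

Lemma fps_eqmM N f f' g g' :
  fps_eqm N f f' -> fps_eqm N g g' -> fps_eqm N (f * g) (f' * g').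
Proof.
move=> ff gg n nN; rewrite !fps_coefM; apply: eq_bigr => i _.
rewrite ff ?gg //; last exact: leq_ltn_trans (leq_ord i) nN.
exact: leq_ltn_trans (leq_subr _ _) nN.
Qed.

Lemma fps_eqmMl N f g g' : fps_eqm N g g' -> fps_eqm N (f * g) (f * g').
Proof. exact: fps_eqmM (fps_eqm_refl _). Qed.

Lemma fps_eqmX N f g p : fps_eqm N f g -> fps_eqm N (f ^+ p) (g ^+ p).
Proof.
by move=> fg; elim: p => [|p IH]; rewrite ?exprS //; apply: fps_eqmM.
Qed.

Lemma fps_eqm_sum N I (r : seq I) (P : pred I) (F G : I -> fps R) :
  (forall i, P i -> fps_eqm N (F i) (G i)) ->
  fps_eqm N (\sum_(i <- r | P i) F i) (\sum_(i <- r | P i) G i).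
Proof.
move=> FG n nN; rewrite !fps_coef_sum; apply: eq_bigr => i Pi; exact: FG.
Qed.

Lemma fps_eqm_prod1 N I (r : seq I) (P : pred I) (F : I -> fps R) :
  (forall i, P i -> fps_eqm N (F i) 1) -> fps_eqm N (\prod_(i <- r | P i) F i) 1.
Proof.
move=> F1; elim/big_ind: _ => // f g f1 g1.
by rewrite -[1 in X in fps_eqm _ _ X]mulr1; apply: fps_eqmM.
Qed.

Lemma fps_eqm_mono_add1 N c k : (N <= k)%N -> fps_eqm N (1 + fps_mono c k) 1.
Proof.
move=> Nk n nN; rewrite fps_coefD /fps_mono.
by case: eqP => [nk|]; rewrite ?addr0 //; lia.
Qed.

Lemma fps_eqm_monoM N M c k f g :
  fps_eqm M f g -> (N <= k + M)%N -> fps_eqm N (fps_mono c k * f) (fps_mono c k * g).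
Proof.
move=> fg NkM n nN; rewrite !fps_coefM_mono; case: leqP => // kn.
by rewrite fg //; lia.
Qed.

(** Strong induction on n: in coefficient n of the two products, g and h occur at index n with
    factor 1 and otherwise only at smaller indices. *)
Lemma fps_eqm_cancel N f g h :
  f 0%N = 1 -> fps_eqm N (f * g) (f * h) -> fps_eqm N g h.
Proof.
move=> f0 fgh; elim/ltn_ind=> n IH nN; have := fgh n nN.
rewrite !fps_coefM !big_ord_recl /= f0 !mul1r subn0.
set s := \sum_(i < n) _; set t := \sum_(i < n) _; suff -> : s = t by apply: addIr.
by apply: eq_bigr => i _; rewrite /bump /= IH //; have := ltn_ord i; lia.
Qed.

Lemma fps_eqmP f g : (forall N, fps_eqm N f g) -> f = g.
Proof. by move=> fg; apply/funext=> n; apply: (fg n.+1). Qed.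

Lemma fps_cancel f g h : f 0%N = 1 -> f * g = f * h -> g = h.
Proof.
by move=> f0 E; apply: fps_eqmP => N; apply: (fps_eqm_cancel f0); rewrite E.
Qed.

Lemma fps_mono_cancel k f g : fps_mono 1 k * f = fps_mono 1 k * g -> f = g.
Proof.
move=> E; apply/funext=> n; have := congr1 (fun h : fps R => h (k + n)%N) E.
by rewrite !fps_coefM_mono leq_addr addKn !mul1r.
Qed.

Lemma fps_prod_coef0 I (r : seq I) (P : pred I) (F : I -> fps R) :
  (forall i, P i -> F i 0%N = 1) -> (\prod_(i <- r | P i) F i) 0%N = 1.
Proof.
move=> F1; elim/big_ind: _ => // f g f1 g1.
by rewrite fps_coef0M f1 g1 mulr1.
Qed.

(** * Dilation [f(X) -> f(X^l)] and extraction of every [l]-th coefficient *)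

Definition fps_dil l f : fps R := fun n => if (l %| n)%N then f (n %/ l)%N else 0.
Definition fps_sect l f : fps R := fun n => f (l * n)%N.
#[global] Arguments fps_dil l%_nat_scope f _%_nat_scope.
#[global] Arguments fps_sect l%_nat_scope f _%_nat_scope.

(** No multiple of l lies strictly between l m and l (m + 1). *)
Lemma sum_multiples l m (F : nat -> R) : (0 < l)%N ->
  (forall i, ~~ (l %| i)%N -> F i = 0) ->
  \sum_(i < (l * m).+1) F i = \sum_(j < m.+1) F (l * j)%N.
Proof.
move=> l0 F0; rewrite -(big_mkord xpredT) -(big_mkord xpredT (fun j => F (l * j)%N)).
elim: m => [|m IH]; first by rewrite muln0 !big_nat1 muln0.
rewrite [RHS]big_nat_recr //= -IH.
rewrite (@big_cat_nat _ _ _ (l * m).+1) //=; last by rewrite ltnS leq_mul.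
congr (_ + _); rewrite big_nat_recr /=; last by rewrite ltn_pmul2l.
rewrite big_nat_cond big1 ?add0r // => i /andP[/andP[i1 i2] _]; apply: F0.
apply/negP=> /dvdnP[k ik]; move: i1 i2; rewrite ik [(k * l)%N]mulnC.
by rewrite !ltn_pmul2l // ltnS ltnNge => /negPf->.
Qed.

Lemma fps_sect_dil l f : (0 < l)%N -> fps_sect l (fps_dil l f) = f.
Proof.
by move=> l0; apply/funext=> n; rewrite /fps_sect /fps_dil dvdn_mulr // mulKn.
Qed.

(** Only indices divisible by l contribute to the convolution, so extraction is linear over the
    series in X^l. *)
Lemma fps_sectM_dil l f g : (0 < l)%N ->
  fps_sect l (fps_dil l g * f) = g * fps_sect l f.
Proof.
move=> l0; apply/funext=> n.
rewrite /fps_sect !fps_coefM (@sum_multiples l n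
  (fun i => fps_dil l g i * f (l * n - i)%N)) //.
  by apply: eq_bigr => i _; rewrite /fps_dil dvdn_mulr // mulKn // mulnBr.
by move=> i /negPf li; rewrite /fps_dil li mul0r.
Qed.

Lemma fps_dilM l f g : (0 < l)%N -> fps_dil l (f * g) = fps_dil l f * fps_dil l g.
Proof.
move=> l0; apply/funext=> n; case: (boolP (l %| n)%N) => [/dvdnP[m ->]|ln].
  rewrite mulnC -[LHS]/(fps_sect l (fps_dil l (f * g)) m) fps_sect_dil //.
  by rewrite -[RHS]/(fps_sect l (fps_dil l f * fps_dil l g) m) fps_sectM_dil // fps_sect_dil.
rewrite fps_coefM /fps_dil (negPf ln) big1 // => i _.
case: ifP => li; last by rewrite mul0r.
case: ifP => lni; last by rewrite mulr0.
by case/negP: ln; have := dvdn_add lni li; rewrite subnK // leq_ord.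
Qed.

Lemma fps_dil_add l : {morph fps_dil l : f g / f + g}.
Proof.
move=> f g; apply/funext=> n; rewrite fps_coefD /fps_dil.
by case: ifP; rewrite ?addr0.
Qed.

Lemma fps_dil_mono l c k : (0 < l)%N -> fps_dil l (fps_mono c k) = fps_mono c (l * k).
Proof.
move=> l0; apply/funext=> n; rewrite /fps_dil /fps_mono.
case: (boolP (l %| n)%N) => [/dvdnP[m ->]|ln].
  by rewrite mulnK // mulnC eqn_pmul2l.
by case: eqP => // nlk; move: ln; rewrite nlk dvdn_mulr.
Qed.

Lemma fps_dilX l f p : (0 < l)%N -> fps_dil l (f ^+ p) = fps_dil l f ^+ p.
Proof.
move=> l0; elim: p => [|p IH]; last by rewrite !exprS fps_dilM ?IH.
by rewrite !expr0 fps_dil_mono // muln0.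
Qed.

Lemma fps_eqm_dil l N M f g :
  (0 < l)%N -> (N <= l * M)%N -> fps_eqm M f g -> fps_eqm N (fps_dil l f) (fps_dil l g).
Proof.
move=> l0 NM fg n nN; rewrite /fps_dil; case: ifP => // ln; apply: fg.
by rewrite ltn_divLR // mulnC; apply: leq_trans nN NM.
Qed.

Lemma fps_dil_comp k l f : (0 < k)%N -> (0 < l)%N ->
  fps_dil k (fps_dil l f) = fps_dil (k * l) f.
Proof.
move=> k0 l0; apply/funext=> n; rewrite /fps_dil.
case: (boolP (k %| n)%N) => [/dvdnP[m ->]|kn].
  by rewrite mulnK // [(m * k)%N]mulnC dvdn_pmul2l // divnMl.
case: ifP => // kln; move: kn; rewrite (dvdn_trans _ kln) //.
exact: dvdn_mulr.
Qed.

(** * Residue classes of exponents *)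

(** The residue r is not reduced, so that classes add under products and scale under powers. *)
Definition fps_class l r f := forall n, f n != 0 -> n = r %[mod l].
#[global] Arguments fps_class (l r)%_nat_scope f.

Lemma fps_classM l r s f g :
  fps_class l r f -> fps_class l s g -> fps_class l (r + s) (f * g).
Proof.
move=> fr gs n fg; 
have [i ne0] : exists i : 'I_n.+1, f i * g (n - i)%N != 0.
  apply/existsP; apply: contraNT fg; rewrite negb_exists => /forallP z.
  by rewrite fps_coefM big1 // => i _; apply/eqP; move: (z i); rewrite negbK.
have fi : f i != 0 by apply: contraNneq ne0 => ->; rewrite mul0r.
have gi : g (n - i)%N != 0 by apply: contraNneq ne0 => ->; rewrite mulr0.
by rewrite -(subnKC (leq_ord i)) -modnDm (fr _ fi) (gs _ gi) modnDm.
Qed.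

Lemma fps_class_sect0 l r f : ~~ (l %| r)%N -> fps_class l r f -> fps_sect l f = 0.
Proof.
move=> lr fr; apply/funext=> n; rewrite /fps_sect.
case: (eqVneq (f (l * n)%N) 0) => [->//|/fr E].
by move: lr; rewrite /dvdn -E modnMr.
Qed.

Lemma fps_class_dil_sect l f : fps_class l 0 f -> fps_dil l (fps_sect l f) = f.
Proof.
move=> f0; apply/funext=> n; rewrite /fps_dil /fps_sect.
case: ifP => ln; first by rewrite mulnC divnK.
by case: (eqVneq (f n) 0) => [->//|/f0]; move/eqP; rewrite mod0n -/(dvdn _ _) ln.
Qed.

End FpsRing.

(** * Enumeration of overpartitions *)

(** Descent is strict before an overlined entry; by transitivity, being sorted for this relation
    places every overlined entry at the first occurrence of its part. *)
Definition follows (x y : nat * bool) : bool :=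
  (y.1 <= x.1)%N && (y.2 ==> (y.1 < x.1)%N).

Lemma follows_trans : transitive follows.
Proof.
move=> [b y] [a x] [c z]; rewrite /follows /= => /andP[ba _] /andP[cb zcb].
by rewrite (leq_trans cb ba); case: z zcb => //= cb'; apply: leq_trans ba.
Qed.

Lemma index_nth_leq (T : eqType) (x0 : T) s i :
  (i < size s)%N -> (index (nth x0 s i) s <= i)%N.
Proof.
elim: s i => // y s IH [|i] /=; rewrite ?eqxx //.
by case: ifP => // _ /IH.
Qed.

Lemma overlined_first_sorted (s : seq (nat * bool)) : sorted geq (unzip1 s) ->
  all (fun i => nth false (unzip2 s) i ==>
                (index (nth 0 (unzip1 s) i) (unzip1 s) == i)%N) (iota 0 (size s))
  = sorted follows s.
Proof.
move=> sg; pose x0 := (0%N, false).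
have n1 i : (i < size s)%N -> nth 0%N (unzip1 s) i = (nth x0 s i).1.
  by move=> i_s; rewrite (nth_map x0).
have n2 i : (i < size s)%N -> nth false (unzip2 s) i = (nth x0 s i).2.
  by move=> i_s; rewrite (nth_map x0).
have geq_trans : transitive geq by move=> a b c /= ab ca; apply: leq_trans ca ab.
have mono i j : (i <= j)%N -> (j < size s)%N -> ((nth x0 s j).1 <= (nth x0 s i).1)%N.
  move=> ij js; rewrite -!n1 //; last exact: leq_ltn_trans js.
  apply: (sorted_leq_nth geq_trans (@leqnn) 0%N sg) => //; rewrite inE size_map //.
  exact: leq_ltn_trans js.
apply/allP/(sortedP x0) => [H i i_s | H i].
  rewrite /follows mono //=; have := H i.+1.
  rewrite mem_iota /= add0n => /(_ i_s); rewrite n1 // n2 //.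
  case: (_.2) => //= /eqP E; rewrite ltn_neqAle mono // andbT.
  apply/negP=> /eqP E'; move: E; rewrite E' -n1 //; last exact: ltnW.
  have : (index (nth 0 (unzip1 s) i) (unzip1 s) <= i)%N.
    by rewrite index_nth_leq // size_map // ltnW.
  by lia.
rewrite mem_iota /= add0n => i_s; rewrite n1 // n2 //; apply/implyP => ov.
set p := (nth x0 s i).1; set k := index p _.
have pin : p \in unzip1 s by rewrite /p -n1 // mem_nth // size_map.
have ki : (k <= i)%N by rewrite /k /p -n1 // index_nth_leq // size_map.
rewrite eqn_leq ki /= leqNgt; apply/negP => ki'.
have i0 : (i.-1.+1 = i)%N by lia.
have := H i.-1; rewrite i0 => /(_ i_s); rewrite /follows ov /= => /andP[_ lt1].
(* An earlier occurrence of p at k < i would force the part at i - 1 down to p, but that part is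
   larger than p. *)
have : ((nth x0 s i.-1).1 <= (nth x0 s k).1)%N by apply: mono; lia.
rewrite -[(nth x0 s k).1]n1; last by lia.
by rewrite nth_index // leqNgt lt1.
Qed.

(** * Overpartitions with bounded parts, enumerated by recursion on the bound *)

Definition overlist (l m n : nat) (s : seq (nat * bool)) : bool :=
  [&& all (fun x => [&& 0 < x.1, x.1 <= m & ~~ (l %| x.1)]%N) s,
      sorted follows s & (sumn (unzip1 s) == n)%N].
Arguments overlist (l m n)%_nat_scope s.

Lemma overpartition_overlist l n m s : (n <= m)%N ->
  is_overpartition n s && all (fun k => ~~ (l %| k)%N) (unzip1 s) = overlist l m n s.
Proof.
move=> nm; rewrite /is_overpartition /overlist.
have sg : sorted follows s -> sorted geq (unzip1 s).
  by rewrite sorted_map; apply: sub_sorted => x y /andP[].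
have bd x : x \in s -> (x.1 <= sumn (unzip1 s))%N.
  move=> xs; have : x.1 \in unzip1 s by apply: map_f.
  elim: (unzip1 s) => //= k r IH; rewrite inE => /orP[/eqP->|/IH h].
    exact: leq_addr.
  exact: leq_trans h (leq_addl _ _).
apply/idP/idP.
  case/andP=> /and4P[pos srt sm ov] nl; rewrite sm -overlined_first_sorted // ov !andbT.
  apply/allP=> x xs; rewrite (allP pos) ?map_f // (allP nl x.1) ?map_f // andbT.
  by rewrite (leq_trans (bd x xs)) // (eqP sm).
case/and3P=> ok srt sm; rewrite sm overlined_first_sorted ?sg // srt !andbT !all_map.
by apply/andP; split; apply/allP=> x /(allP ok) /and3P[].
Qed.

Lemma overlist_nil l m n : overlist l m n [::] = (n == 0)%N.
Proof. by rewrite /overlist /= eq_sym. Qed.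

(** Bounding the tail by a makes it descend from the head; it remains to exclude an overlined a in
    the tail, and in a sorted tail that could only be the first entry. *)
Lemma overlist_cons l m n a b s :
  overlist l m n ((a, b) :: s) =
  [&& (0 < a <= m)%N, ~~ (l %| a)%N, (a <= n)%N, overlist l a (n - a) s &
      ohead s != Some (a, true)].
Proof.
rewrite /overlist /= (path_sortedE follows_trans).
apply/idP/idP.
  case/and3P=> /andP[/and3P[a0 am la] ok] /andP[fs srt] /eqP sm.
  rewrite a0 am la srt; apply/and5P; split=> //; first by lia.
    apply/andP; split; last by lia.
    apply/allP=> x xs; have /and3P[-> _ ->] := allP ok x xs.
    by have /andP[->] := allP fs x xs.
  case: s fs {ok srt sm} => //= x s /andP[/andP[_ H] _].
  by apply/eqP=> -[E]; move: H; rewrite E /= ltnn.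
case/and5P=> /andP[a0 am] la an /and3P[ok srt sm] hd.
rewrite a0 am la srt /= andbT; apply/and3P; split; last by lia.
  apply/allP=> x xs; have /and3P[-> xa ->] := allP ok x xs.
  by rewrite (leq_trans xa am).
apply/allP=> x xs; rewrite /follows; have /and3P[_ xa _] := allP ok x xs.
rewrite xa /=; apply/implyP=> x2; rewrite ltn_neqAle xa andbT.
apply/negP=> /eqP xa'.
have {}x2 : x = (a, true) by rewrite [x]surjective_pairing xa' x2.
move: xs hd ok srt; rewrite {x xa xa'}x2.
case: s sm => //= y s _; rewrite inE => /orP[/eqP->|ins]; first by rewrite eqxx.
move=> _ /andP[/and3P[_ ya _] _]; rewrite (path_sortedE follows_trans).
by case/andP=> /allP/(_ _ ins); rewrite /follows /= ltnNge ya andbF.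
Qed.

Lemma overlist_le l m m' n s : overlist l m n s -> (m <= m')%N -> overlist l m' n s.
Proof.
move=> + mm'; rewrite /overlist => /and3P[H -> ->]; rewrite !andbT.
by apply/allP=> x /(allP H) /and3P[-> xm ->]; rewrite (leq_trans xm).
Qed.

(** Puts plain copies of k in front of the lists from [e]. The argument [fuel] only serves
    structural recursion: for positive k, any amount of at least n gives the same lists. *)
Fixpoint repeats (k : nat) (e : nat -> seq (seq (nat * bool))) (fuel n : nat) :=
  e n ++ (if fuel is f.+1 then
            if (k <= n)%N then map (cons (k, false)) (repeats k e f (n - k)%N) else [::]
          else [::]).

(** For an allowed part m, [repeats] accounts for the factor 1/(1 - X^m), and the optional overlined
    copy in front for 1 + X^m. *)
Fixpoint overlists (l m n : nat) : seq (seq (nat * bool)) :=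
  if m is m'.+1 then
    if (l %| m)%N then overlists l m' n else
    repeats m (overlists l m') n n ++
      (if (m <= n)%N then
         map (cons (m, true)) (repeats m (overlists l m') (n - m)%N (n - m)%N)
       else [::])
  else if (n == 0)%N then [:: [::]] else [::].

Lemma repeats_fuel k e f1 f2 n : (0 < k)%N -> (n <= f1)%N -> (n <= f2)%N ->
  repeats k e f1 n = repeats k e f2 n.
Proof.
move=> k0; elim: f1 f2 n => [|f1 IH] [|f2] n //= n1 n2.
- by have -> : (k <= n)%N = false by lia.
- by have -> : (k <= n)%N = false by lia.
by case: ifP => // kn; rewrite (IH f2) //; lia.
Qed.

Lemma map_cons_uniq (x : nat * bool) r : uniq r -> uniq (map (cons x) r).
Proof. by move=> ur; rewrite map_inj_uniq // => s t []. Qed.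

Lemma mem_map_cons (x : nat * bool) r s :
  (s \in map (cons x) r) = if s is y :: t then (y == x) && (t \in r) else false.
Proof.
apply/mapP/idP => [[t tr ->]|]; first by rewrite eqxx.
by case: s => // y t /andP[/eqP-> tr]; exists t.
Qed.

Lemma mem_repeats l m e f n s :
  ~~ (l %| m.+1)%N -> (forall n t, (t \in e n) = overlist l m n t) -> (n <= f)%N ->
  (s \in repeats m.+1 e f n) =
  overlist l m.+1 n s && (ohead s != Some (m.+1, true)).
Proof.
move=> lm eP; elim: f n s => [|f IH] n s nf /=.
  rewrite cats0 eP; case: s => [|[a b] s]; first by rewrite !overlist_nil andbT.
  rewrite !overlist_cons /=.
  have [->|a0] := posnP a => //.
  by rewrite (_ : (a <= n)%N = false) ?andbF //; lia.
rewrite mem_cat eP; case: s => [|[a b] s].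
  rewrite !overlist_nil /= andbT orbC; case: ifP => // _.
  by rewrite mem_map_cons.
(* The first part a is compared with m + 1: below it the list comes from [e], above it neither side
   holds, and at equality only a plain copy can be peeled off. *)
case: (ltngtP a m.+1) => am.
- have -> : ((a, b) :: s \in if (m < n)%N then
      [seq (m.+1, false) :: i | i <- repeats m.+1 e f (n - m.+1)%N] else [::]) = false.
    case: ifP => // _; rewrite mem_map_cons; apply/negP=> /andP[/eqP[E _] _]; lia.
  rewrite orbF !overlist_cons /= (_ : (a <= m)%N) // (ltnW am) !andbT.
  rewrite (_ : Some (a, b) != _) ?andbT //; apply/eqP=> -[E _]; lia.
- rewrite !overlist_cons /= (_ : (a <= m)%N = false) ?andbF; last lia.
  rewrite (_ : (a <= m.+1)%N = false) ?andbF /=; last lia.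
  case: ifP => // _; rewrite mem_map_cons; apply/negP=> /andP[/eqP[E _] _]; lia.
rewrite {a}am !overlist_cons ltnn leqnn /= lm /=.
case: leqP => mn; rewrite ?andbF // mem_map_cons IH; last lia.
case: b; first by rewrite eqxx !andbF xpair_eqE andbF.
by rewrite eqxx /= (_ : Some _ != _) ?andbT //; apply/eqP=> -[].
Qed.

Lemma repeats_uniq l m e f n : ~~ (l %| m.+1)%N ->
  (forall n t, (t \in e n) = overlist l m n t) -> (forall n, uniq (e n)) ->
  uniq (repeats m.+1 e f n).
Proof.
move=> lm eP eu; elim: f n => [|f IH] n; first by rewrite /= cats0.
rewrite /= cat_uniq eu /=; case: ifP => // mn.
rewrite map_cons_uniq // andbT; apply/hasPn=> s; rewrite mem_map_cons.
case: s => // y t /andP[/eqP-> _]; rewrite eP overlist_cons.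
by rewrite ltnn /=.
Qed.

Lemma overlists_spec l m n :
  uniq (overlists l m n) /\ forall s, (s \in overlists l m n) = overlist l m n s.
Proof.
elim: m n => [|m IH] n.
  split=> [|[|[a b] s]]; first by rewrite /=; case: ifP.
    by rewrite overlist_nil /=; case: ifP.
  rewrite overlist_cons /= (_ : (0 < a <= 0)%N = false); last lia.
  by case: ifP.
rewrite /=; case: ifPn => lm.
  split=> [|s]; first by case: (IH n).
  rewrite (IH n).2; apply/idP/idP=> [/overlist_le|]; first exact.
  rewrite /overlist => /and3P[H -> ->]; rewrite !andbT; apply/allP=> x xs.
  have /and3P[-> xm lx] := allP H x xs; rewrite lx andbT /=.
  move: xm; rewrite leq_eqVlt => /orP[/eqP E|//]; by rewrite E lm in lx.
have eP k t := (IH k).2 t; have eu k := (IH k).1.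
split=> [|s].
  rewrite cat_uniq (repeats_uniq _ _ lm eP) //=; case: ifP => // mn.
  rewrite map_cons_uniq ?(repeats_uniq _ _ lm eP) // andbT.
  apply/hasPn=> s; rewrite mem_map_cons.
  by case: s => // y t /andP[/eqP-> _]; rewrite (mem_repeats _ lm eP) //= eqxx andbF.
rewrite mem_cat (mem_repeats _ lm eP) //.
case: s => [|[a b] s].
  by rewrite overlist_nil /= andbT orbC; case: ifP => // _; rewrite mem_map_cons.
case: (eqVneq (a, b) (m.+1, true)) => [[-> ->]|ne].
  rewrite /= eqxx andbF /= overlist_cons leqnn lm /=.
  by case: leqP => // mn; rewrite mem_map_cons eqxx /= (mem_repeats _ lm eP).
rewrite (_ : (ohead _ != _)) ?andbT; last by apply: contraNneq ne => -[-> ->].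
rewrite orbC; case: ifP => // _; rewrite mem_map_cons (negPf ne); by [].
Qed.

(** Parts never exceed n, so any bound m >= n will do, and one m serves all coefficients up to
    it. *)
Lemma overA_overlists l n m : (n <= m)%N -> overA l n = size (overlists l m n).
Proof.
move=> nm; rewrite /overA cardsE cardE.
pose F (s : n.-bseq ('I_n.+1 * bool)) := forget_bound s.
have Finj : injective F by move=> s t /forget_bound_inj /val_inj.
rewrite -(size_map F); apply: perm_size; have [ou oP] := overlists_spec l m n.
apply: uniq_perm => //; first by rewrite map_inj_uniq // enum_uniq.
move=> s; rewrite oP -(overpartition_overlist l s nm); apply/mapP/idP => [[t]|].
  by rewrite mem_enum => tA ->.
move=> sP; have [t ts] := overpartition_bounded (proj1 (andP sP)).
by exists t; rewrite // mem_enum /in_mem /= ts.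
Qed.

(** * The finite q-binomial theorem *)

Section QBinomial.
Variables (A : comNzRingType) (Q : A).

(** Gaussian binomial coefficients, by the q-Pascal rule to avoid division in [A]. *)
Fixpoint qbin (m k : nat) : A :=
  match m, k with
  | _, 0 => 1
  | 0, _.+1 => 0
  | m'.+1, k'.+1 => qbin m' k' + Q ^+ k * qbin m' k
  end.

Definition qfact m : A := \prod_(i < m) (1 - Q ^+ i.+1).

Lemma qbin_m0 m : qbin m 0 = 1. Proof. by case: m. Qed.

Lemma qbin_small m k : (m < k)%N -> qbin m k = 0.
Proof.
elim: m k => [|m IH] [|k] //= mk; rewrite !IH ?mulr0 ?addr0 //; lia.
Qed.

Lemma qfactS m : qfact m.+1 = qfact m * (1 - Q ^+ m.+1).
Proof. exact: big_ord_recr. Qed.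

(** Follows from the q-Pascal rule and 1 - Q^(m+1) = (1 - Q^(k+1)) + Q^(k+1) (1 - Q^(m-k)). *)
Lemma qbin_fact m k : (k <= m)%N -> qbin m k * qfact k * qfact (m - k) = qfact m.
Proof.
elim: m k => [|m IH] [|k] //= km; rewrite ?subn0.
- by rewrite /qfact big_ord0 !mulr1.
- by rewrite /qfact big_ord0 !mul1r.
rewrite subSS 2!mulrDl.
have -> : qbin m k * qfact k.+1 * qfact (m - k) = (1 - Q ^+ k.+1) * qfact m.
  by rewrite -(IH k) // qfactS; ring.
case: (ltngtP k m) => [lt_km||E]; [|lia|].
- have -> : Q ^+ k.+1 * qbin m k.+1 * qfact k.+1 * qfact (m - k)
      = Q ^+ k.+1 * (1 - Q ^+ (m - k)) * qfact m.
    have E : (m - k = (m - k.+1).+1)%N by lia.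
    by rewrite -(IH k.+1) // E (qfactS (m - k.+1)); ring.
  have E : Q ^+ m.+1 = Q ^+ k.+1 * Q ^+ (m - k) by rewrite -exprD; congr (_ ^+ _); lia.
  by rewrite qfactS E; ring.
rewrite E qbin_small // qfactS; ring.
Qed.

(** The factors after the first form the same product with x Q for x, and the q-Pascal rule merges
    the two sums. The second variable y keeps the later substitution free of negative powers of
    X. *)
Lemma qbinomial_theorem m (x y : A) :
  \prod_(i < m) (y + x * Q ^+ i) =
  \sum_(k < m.+1) Q ^+ 'C(k, 2) * qbin m k * x ^+ k * y ^+ (m - k).
Proof.
elim: m x => [|m IH] x; first by rewrite big_ord0 big_ord1 !expr0 !mulr1.
rewrite big_ord_recl expr0 mulr1.
under eq_bigr => i _ do rewrite /bump /= ?add1n exprS mulrA.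
rewrite IH mulrDl mulr_sumr mulr_sumr.
rewrite [RHS]big_ord_recl /= [X in X + _ = _]big_ord_recl /=.
rewrite !qbin_m0 !expr0 subn0 !mulr1 !mul1r -exprS -addrA; congr (_ + _).
have -> : \sum_(i < m) y * (Q ^+ 'C(bump 0 i, 2) * qbin m (bump 0 i) *
     (x * Q) ^+ bump 0 i * y ^+ (m - bump 0 i)) =
   \sum_(i < m.+1) Q ^+ 'C(i.+1, 2) * (Q ^+ i.+1 * qbin m i.+1) * x ^+ i.+1 * y ^+ (m - i).
  (* The summand added at index m vanishes together with [qbin m m.+1]. *)
  rewrite big_ord_recr /= qbin_small // !(mulr0, mul0r) addr0.
  apply: eq_bigr => i _; rewrite /bump /= ?add1n exprMn.
  by rewrite -[(m - i)%N]prednK ?subn_gt0 // -subnS [y ^+ (_).+1]exprS; ring.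
rewrite -big_split; apply: eq_bigr => i _; rewrite /= /bump /= ?add1n subSS.
by rewrite binS bin1 exprD exprMn !exprS; ring.
Qed.

End QBinomial.

(** * Gauss' identity for the theta series *)

Definition zrange (N : nat) : seq int := [seq k%:Z - N%:Z | k <- iota 0 (2 * N).+1].

Lemma mem_zrange N z : (z \in zrange N) = (`|z| <= N)%N.
Proof.
apply/mapP/idP => [[k]|zN]; first by rewrite mem_iota => kN ->; lia.
by exists (absz (z + N%:Z)); [rewrite mem_iota|]; lia.
Qed.

Lemma zrange_uniq N : uniq (zrange N).
Proof. by rewrite map_inj_uniq ?iota_uniq // => i j; lia. Qed.

Lemma big_zrange (R : nmodType) n N (F : int -> R) : (n <= N)%N ->
  (forall z, (n < `|z|)%N -> F z = 0) ->
  \sum_(z <- zrange N) F z = \sum_(z <- zrange n) F z.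
Proof.
move=> nN F0; rewrite (bigID (fun z : int => `|z| <= n)%N) /=.
rewrite [X in _ + X]big1 ?addr0 => [|z]; last by rewrite -ltnNge => /F0.
rewrite -big_filter; apply: perm_big; apply: uniq_perm.
- exact/filter_uniq/zrange_uniq.
- exact: zrange_uniq.
by move=> z; rewrite mem_filter !mem_zrange; lia.
Qed.

Lemma prod_ord_recr_cond (A : comNzRingType) m (P : pred nat) (F : nat -> A) :
  \prod_(k < m.+1 | P k) F k = \prod_(k < m | P k) F k * (if P m then F m else 1).
Proof. by rewrite big_mkcond big_ord_recr /= -big_mkcond. Qed.

Section Theta.
Variable R : comNzRingType.
Notation x := (fps_mono (1 : R)).

(** The range |z| <= n suffices for coefficient n, since z^2 = n forces |z| <= n. *)
Definition theta : fps R :=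
  fun n => \sum_(z <- zrange n) fps_mono ((-1) ^+ absz z) (absz z ^ 2) n.

Lemma thetaE n N : (n <= N)%N ->
  theta n = \sum_(z <- zrange N) fps_mono ((-1) ^+ absz z) (absz z ^ 2) n.
Proof.
move=> nN; apply/esym/big_zrange => // z nz.
by rewrite /fps_mono; case: eqP => // E; nia.
Qed.

Lemma theta_eqm N :
  fps_eqm N.+1 theta (\sum_(z <- zrange N) fps_mono ((-1) ^+ absz z) (absz z ^ 2)).
Proof. by move=> n nN; rewrite fps_coef_sum (thetaE (N := N)). Qed.

Lemma theta0 : theta 0%N = 1.
Proof. by rewrite /theta big_seq1. Qed.

(** In the usual notation, [poch (-1) m] is (X;X)_m and [poch 1 m] is (-X;X)_m. *)
Definition poch (c : R) m : fps R := \prod_(k < m) (1 + fps_mono c k.+1).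

Lemma poch_eqm c m n : (m <= n)%N -> fps_eqm m.+1 (poch c n) (poch c m).
Proof.
move=> /subnKC <-; rewrite /poch big_split_ord /= -[X in fps_eqm _ _ X]mulr1.
apply: fps_eqmMl; apply: fps_eqm_prod1 => i _; apply: fps_eqm_mono_add1; lia.
Qed.

Lemma poch_coef0 c m : poch c m 0%N = 1.
Proof. by apply: fps_prod_coef0 => i _; rewrite fps_coefD fps_coef1 addr0. Qed.

Lemma fps_mono1X k m : x k ^+ m = x (k * m).
Proof. by rewrite fps_monoX expr1n. Qed.

Lemma fps_mono1M k m : x k * x m = x (k + m).
Proof. by rewrite fps_monoM mulr1. Qed.

Lemma fps_monoN c k : fps_mono (- c) k = - fps_mono c k :> fps R.
Proof.
by apply/funext=> n; rewrite fps_coefN /fps_mono; case: eqP; rewrite ?oppr0.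
Qed.

Lemma qfact_dil m : qfact (x 2) m = fps_dil 2 (poch (-1) m).
Proof.
elim: m => [|m IH].
  by rewrite /qfact /poch !big_ord0 fps_dil_mono.
rewrite qfactS IH /poch big_ord_recr /= fps_dilM // fps_dil_add !fps_dil_mono //.
by rewrite muln0 fps_mono1X fps_monoN.
Qed.

Lemma qfact_eqm m n : (m <= n)%N ->
  fps_eqm (2 * m.+1) (qfact (x 2) n) (qfact (x 2) m).
Proof.
by move=> mn; rewrite !qfact_dil; apply: (fps_eqm_dil (M := m.+1)) => //; apply: poch_eqm.
Qed.

(** * Product form of the theta series and Gauss' identity *)

Definition odd_poch n : fps R := \prod_(i < n) (1 - x (2 * i).+1).

(* The q-binomial theorem in base [X^2], with [2n] factors [X^(2n-1) - X^(2i)]: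
   both sides are divisible by [X^(n(n-1) + n(2n-1))]. *)
Lemma finite_jacobi n :
  odd_poch n ^+ 2 = \sum_(k < (2 * n).+1)
    fps_mono ((-1) ^+ absz (k%:Z - n%:Z)) (absz (k%:Z - n%:Z) ^ 2) * qbin (x 2) (2 * n) k.
Proof.
set e := (n * (n - 1) + n * (2 * n - 1))%N.
have := qbinomial_theorem (x 2) (2 * n) (-1) (x (2 * n - 1)).
have -> : \prod_(i < 2 * n) (x (2 * n - 1) + -1 * x 2 ^+ i) =
          (-1) ^+ n * (x e * odd_poch n ^+ 2).
  rewrite mul2n -addnn big_split_ord /= addnn -mul2n.
  (* For i < n, X^(2n-1) - X^(2i) = -X^(2i) (1 - X^(2(n-i)-1)); the odd exponents come in reverse
     order. *)
  have -> : \prod_(i < n) (x (2 * n - 1) + -1 * x 2 ^+ i)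
            = (-1) ^+ n * (x (n * (n - 1)) * odd_poch n).
    have -> : x (n * (n - 1)) = \prod_(i < n) x (2 * i).
      elim: (n) => [|m IH]; first by rewrite big_ord0.
      rewrite big_ord_recr /= -IH fps_mono1M; congr (x _); nia.
    have -> : odd_poch n = \prod_(i < n) (1 - x (2 * (n - i.+1)).+1).
      exact: reindex_inj rev_ord_inj.
    rewrite -[X in (-1) ^+ X](card_ord n) -prodr_const -!big_split /=.
    apply: eq_bigr => i _; have i_n := ltn_ord i; rewrite fps_mono1X.
    have -> : (2 * n - 1 = 2 * i + (2 * (n - i.+1)).+1)%N by lia.
    rewrite -fps_mono1M; ring.
  (* In the upper half X^(2n-1) is the lower power; taking it out leaves 1 - X^(2i+1). *)
  have -> : \prod_(i < n) (x (2 * n - 1) + -1 * x 2 ^+ (n + i))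
            = x (n * (2 * n - 1)) * odd_poch n.
    have -> : x (n * (2 * n - 1)) = \prod_(i < n) x (2 * n - 1).
      by rewrite prodr_const card_ord fps_mono1X mulnC.
    rewrite -big_split /=.
    apply: eq_bigr => i _; have i_n := ltn_ord i; rewrite fps_mono1X.
    have -> : (2 * (n + i) = (2 * n - 1) + (2 * i).+1)%N by lia.
    rewrite -fps_mono1M; ring.
  by rewrite /e -fps_mono1M; ring.
have -> : \sum_(k < (2 * n).+1) x 2 ^+ 'C(k, 2) * qbin (x 2) (2 * n) k * (-1) ^+ k *
            x (2 * n - 1) ^+ (2 * n - k) =
          (-1) ^+ n * (x e * \sum_(k < (2 * n).+1)
            fps_mono ((-1) ^+ absz (k%:Z - n%:Z)) (absz (k%:Z - n%:Z) ^ 2)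
            * qbin (x 2) (2 * n) k).
  rewrite !mulr_sumr; apply: eq_bigr => k _; rewrite !fps_mono1X.
  have := ltn_ord k; set q := qbin _ _ _; set d := absz _.
  move: (nat_of_ord k) @d q => {}k d q kn.
  have -> : fps_mono ((-1) ^+ d) (d ^ 2) = (-1) ^+ d * x (d ^ 2) :> fps R.
    rewrite -signr_odd -[in RHS]signr_odd.
    by case: (odd d); rewrite ?expr0 ?mul1r // expr1 fps_monoN mulN1r.
  have -> : (-1) ^+ k = (-1) ^+ n * (-1) ^+ d :> fps R.
    rewrite -exprD -signr_odd -[RHS]signr_odd; congr (_ ^+ nat_of_bool _); rewrite /d; lia.
  have -> : (-1) ^+ n * (x e * ((-1) ^+ d * x (d ^ 2) * q)) =
            x e * x (d ^ 2) * ((-1) ^+ n * (-1) ^+ d * q) by ring.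
  (* Completing the square: k (k - 1) + (2n - 1) (2n - k) = e + (k - n)^2. *)
  rewrite fps_mono1M; have -> : (e + d ^ 2 = 2 * 'C(k, 2) + (2 * n - 1) * (2 * n - k))%N.
    have -> : (2 * 'C(k, 2) = k * (k - 1))%N.
      by elim: (k) => // j IH; rewrite binS bin1; nia.
    rewrite /e /d -mulnn; nia.
  by rewrite -fps_mono1M; ring.
by move/(inv_inj (signrMK n))/fps_mono_cancel.
Qed.

(** With d = |k - n| and j = n - d, the indices k and 2n - k are j and n + d in some order. To the
    stated order [qfact] takes the same value at j, n, n + d and 2n, so all factors of the binomial
    cancel. *)
Lemma qfact_qbin_eqm n k : (k <= 2 * n)%N ->
  fps_eqm (2 * (n - absz (k%:Z - n%:Z)).+1) (qfact (x 2) n * qbin (x 2) (2 * n) k) 1.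
Proof.
move=> kn; set d := absz _; set j := (n - d)%N.
apply: (@fps_eqm_cancel _ _ (qfact (x 2) j)).
  by rewrite qfact_dil -[RHS](poch_coef0 (-1) j) /fps_dil dvdn0 div0n.
rewrite mulr1; apply: fps_eqm_trans (qfact_eqm (n := 2 * n) _); last by lia.
rewrite -(qbin_fact (x 2) kn).
have -> : qbin (x 2) (2 * n) k * qfact (x 2) k * qfact (x 2) (2 * n - k)
        = qfact (x 2) j * qbin (x 2) (2 * n) k * qfact (x 2) (n + d).
  have [[E1 E2]|[E1 E2]] :
    ((k = j /\ 2 * n - k = n + d) \/ (k = n + d /\ 2 * n - k = j))%N by lia.
    by rewrite E2 (congr1 (qfact (x 2)) E1); ring.
  by rewrite E2 (congr1 (qfact (x 2)) E1); ring.
rewrite mulrCA mulrC; apply: fps_eqmMl.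
apply: (fps_eqm_trans (qfact_eqm _)); first by lia.
by apply/fps_eqm_sym/qfact_eqm; lia.
Qed.

Lemma theta_qfact n :
  fps_eqm n.+1 (theta : fps R) (qfact (x 2) n * odd_poch n ^+ 2).
Proof.
apply: (fps_eqm_trans (@theta_eqm n)); rewrite finite_jacobi mulr_sumr.
rewrite /zrange big_map -[iota _ _]/(index_iota 0 (2 * n).+1) big_mkord.
apply: fps_eqm_sum => k _; have kn := ltn_ord k; set d := absz _.
rewrite mulrCA -[X in fps_eqm _ X _]mulr1.
(* The factor X^(d^2) raises the precision enough: d^2 + 2 (n - d + 1) = (d - 1)^2 + 2n + 1 exceeds
   n. *)
by apply/(fps_eqm_monoM _ (fps_eqm_sym (qfact_qbin_eqm _))); nia.
Qed.

Lemma poch_oddM n : poch (-1) (2 * n) = odd_poch n * qfact (x 2) n.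
Proof.
elim: n => [|n IH]; first by rewrite /poch /odd_poch /qfact !big_ord0 mulr1.
rewrite /odd_poch big_ord_recr qfactS /= -/(odd_poch n) mulrACA -IH.
rewrite mulnS /poch !big_ord_recr /= !fps_monoN fps_mono1X mulnS -mulrA; congr (_ * (_ * _)).
Qed.

Lemma poch_mul m : poch (-1) m * poch 1 m = qfact (x 2) m.
Proof.
rewrite -big_split; apply: eq_bigr => i _ /=.
by rewrite fps_monoN fps_mono1X mul2n -addnn -fps_mono1M; ring.
Qed.

(** The product form of [theta] collapses by (X;X)_2n = (X;X^2)_n (X^2;X^2)_n and (X;X)_2n (-X;X)_2n
    = (X^2;X^2)_2n; length 2n is what allows the split into odd and even exponents. *)
Lemma gauss_theta n : fps_eqm n.+1 (theta * poch 1 n) (poch (-1) n).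
Proof.
have le1 : (n <= 2 * n)%N by lia.
apply: fps_eqm_trans (poch_eqm _ le1).
apply: fps_eqm_trans (fps_eqmMl _ (fps_eqm_sym (poch_eqm 1 le1))) _.
apply: fps_eqm_trans (fps_eqmM (@theta_qfact n) (@fps_eqm_refl _ _ _)) _.
have -> : qfact (x 2) n * odd_poch n ^+ 2 * poch 1 (2 * n) = odd_poch n * qfact (x 2) (2 * n).
  by rewrite -(poch_mul (2 * n)) poch_oddM; ring.
rewrite poch_oddM; apply: fps_eqmMl; apply: fps_eqm_le (qfact_eqm le1); lia.
Qed.

(** * The generating function of [overA] *)

(** The product of (1 + X^k)/(1 - X^k) over the allowed parts k <= m, with denominators cleared. *)
Lemma overlists_mul l m :
  (\prod_(k < m | ~~ (l %| k.+1)%N) (1 + fps_mono (-1) k.+1)) *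
    ((fun n => (size (overlists l m n))%:R) : fps R)
  = \prod_(k < m | ~~ (l %| k.+1)%N) (1 + x k.+1).
Proof.
elim: m => [|m IH].
  by rewrite !big_ord0 mul1r; apply/funext=> n; rewrite fps_coef1 /=; case: eqP.
rewrite !(prod_ord_recr_cond _ (fun k => ~~ (l %| k.+1)%N) (fun k => 1 + fps_mono _ k.+1)).
rewrite /=; case: (boolP (l %| m.+1)%N) => lm /=; first by rewrite !mulr1 IH.
set e := overlists l m in IH *.
pose N : fps R := fun n => (size (repeats m.+1 e n n))%:R.
have -> : (fun n => (size (repeats m.+1 e n n ++
   (if (m < n)%N then
      [seq (m.+1, true) :: i | i <- repeats m.+1 e (n - m.+1) (n - m.+1)]
    else [::])))%:R)
   = (1 + x m.+1) * N.
  apply/funext=> n; rewrite mulrDl mul1r fps_coefD fps_coefM_mono size_cat natrD.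
  by case: ifP => _; rewrite ?size_map ?mul1r.
(* The recursion of [repeats] says that N is the series of [e] plus X^(m+1) N. *)
have E : (1 + fps_mono (-1) m.+1) * N = (fun n => (size (e n))%:R).
  apply/funext=> n; rewrite mulrDl mul1r fps_coefD fps_coefM_mono /N.
  case: n => [|n] /=; first by rewrite cats0 addr0.
  rewrite size_cat natrD ltnS; case: ifP => mn; last by rewrite !addr0.
  by rewrite size_map mulN1r subSS (@repeats_fuel _ _ n (n - m)) ?addrK // leq_subr.
by rewrite -IH -E; ring.
Qed.

Lemma prod_multiples (A : comNzRingType) l m (F : nat -> A) : (0 < l)%N ->
  \prod_(k < m | (l %| k.+1)%N) F k.+1 = \prod_(j < m %/ l) F (l * j.+1)%N.
Proof.
move=> l0; elim: m => [|m IH]; first by rewrite div0n !big_ord0.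
rewrite (prod_ord_recr_cond _ (fun k => (l %| k.+1)%N) (fun k => F k.+1)) IH divnS //.
case: ifP => lm; last by rewrite mulr1.
rewrite add1n big_ord_recr /=; congr (_ * F _).
by move: (divnS m l0); rewrite lm add1n => <-; rewrite mulnC divnK.
Qed.

Lemma dil_poch l c m : (0 < l)%N ->
  fps_dil l (poch c m) = \prod_(j < m) (1 + fps_mono c (l * j.+1)).
Proof.
move=> l0; rewrite /poch; elim: m => [|m IH].
  by rewrite !big_ord0 fps_dil_mono // muln0.
by rewrite !big_ord_recr /= fps_dilM // IH fps_dil_add !fps_dil_mono // muln0.
Qed.

(** The product of (1 + X^k)/(1 - X^k) over k not divisible by l is the full product divided by its
    dilation; by Gauss' identity these two are 1/th and 1/th(X^l). *)
Lemma overA_theta l : (0 < l)%N ->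
  theta * ((fun n => (overA l n)%:R) : fps R) = fps_dil l theta.
Proof.
move=> l0; apply: fps_eqmP => N.
set T : fps R := fun n => (size (overlists l N n))%:R.
have GT : fps_eqm N (fun n => (overA l n)%:R) T.
  by move=> n nN; rewrite /T (@overA_overlists l n N) // ltnW.
apply: fps_eqm_trans (fps_eqmMl _ GT) _.
set d := fps_dil l; set M := (N %/ l)%N.
(* This factor lets Gauss' identity turn [theta] and its dilation into finite products; M counts the
   multiples of l up to N. *)
apply: (@fps_eqm_cancel _ _ (poch 1 N * d (poch 1 M))).
  by rewrite fps_coef0M poch_coef0 mul1r /d /fps_dil dvdn0 div0n poch_coef0.
have split c : poch c N =
    d (poch c M) * \prod_(k < N | ~~ (l %| k.+1)%N) (1 + fps_mono c k.+1).
  rewrite /d dil_poch // /M -(prod_multiples N (fun k => 1 + fps_mono c k)) //.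
  by rewrite /poch (bigID (fun k : 'I_N => (l %| k.+1)%N)).
have g1 : fps_eqm N (theta * poch 1 N) (poch (-1) N).
  by apply: fps_eqm_le (@gauss_theta N).
have g2 : fps_eqm N (d theta * d (poch 1 M)) (d (poch (-1) M)).
  rewrite /d -fps_dilM //; apply: (fps_eqm_dil l0 _ (@gauss_theta M)).
  by rewrite mulnC; apply/ltnW/ltn_ceil.
have -> : poch 1 N * d (poch 1 M) * (theta * T) =
    (d (poch 1 M) * T) * (theta * poch 1 N) by ring.
apply: fps_eqm_trans (fps_eqmMl _ g1) _.
have -> : d (poch 1 M) * T * poch (-1) N = poch 1 N * d (poch (-1) M).
  by rewrite !split -(overlists_mul l N) -/T; ring.
have -> : poch 1 N * d (poch 1 M) * d theta = poch 1 N * (d theta * d (poch 1 M)) by ring.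
exact/fps_eqmMl/fps_eqm_sym.
Qed.

End Theta.

(** * Sums of two squares *)

Definition two_squares (N n : nat) : seq (int * int) :=
  [seq p <- [seq (z, w) | z <- zrange N, w <- zrange N] |
     (absz p.1 ^ 2 + absz p.2 ^ 2 == n)%N].

Lemma mem_two_squares N n p : (n <= N)%N ->
  (p \in two_squares N n) = (p.1 ^+ 2 + p.2 ^+ 2 == n%:Z).
Proof.
move=> nN; case: p => z w; rewrite mem_filter.
have -> : ((z, w) \in [seq (a, b) | a <- zrange N, b <- zrange N]) =
          (`|z| <= N)%N && (`|w| <= N)%N.
  rewrite -!mem_zrange; apply/allpairsP/andP => [[[a b] [aN bN [-> ->]]] //|[zN wN]].
  by exists (z, w).
rewrite /=; apply/idP/idP; nia.
Qed.

Lemma two_squares_uniq N n : uniq (two_squares N n).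
Proof.
by apply: filter_uniq; apply: allpairs_uniq; rewrite ?zrange_uniq // => -[? ?] [].
Qed.

(* Multiplication by [2 + i], [2 - i] and [5] on Gaussian integers. *)
Definition mul_2pi (p : int * int) : int * int := (2 * p.1 - p.2, p.1 + 2 * p.2).
Definition mul_2mi (p : int * int) : int * int := (2 * p.1 + p.2, 2 * p.2 - p.1).
Definition mul_5 (p : int * int) : int * int := (5 * p.1, 5 * p.2).

(** If x + i y = (2 + i)(a + i b), then x - 2y = -5b and y = a + 2b; conversely these two equations
    recover a and b. *)
Lemma mem_mul_2pi N n x y : (n <= N)%N ->
  ((x, y) \in map mul_2pi (two_squares N n)) =
  (x ^+ 2 + y ^+ 2 == (5 * n)%:Z) && (5 %| x - 2 * y)%Z.
Proof.
move=> nN; apply/mapP/andP => [[[a b]]|[/eqP E /dvdzP[k xk]]].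
  rewrite mem_two_squares //= => /eqP E [-> ->]; split; last lia.
  by apply/eqP; rewrite PoszM -E; ring.
exists (2 * k + y, -k); last by rewrite /mul_2pi /=; congr (_, _); lia.
by rewrite mem_two_squares //=; apply/eqP; nia.
Qed.

Lemma mem_mul_2mi N n x y : (n <= N)%N ->
  ((x, y) \in map mul_2mi (two_squares N n)) =
  (x ^+ 2 + y ^+ 2 == (5 * n)%:Z) && (5 %| x + 2 * y)%Z.
Proof.
move=> nN; apply/mapP/andP => [[[a b]]|[/eqP E /dvdzP[k xk]]].
  rewrite mem_two_squares //= => /eqP E [-> ->]; split; last lia.
  by apply/eqP; rewrite PoszM -E; ring.
exists (2 * k - y, k); last by rewrite /mul_2mi /=; congr (_, _); lia.
by rewrite mem_two_squares //=; apply/eqP; nia.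
Qed.

Lemma mem_mul_5 N n x y : (n <= N)%N ->
  ((x, y) \in if (5 %| n)%N then map mul_5 (two_squares N (n %/ 5)) else [::]) =
  [&& x ^+ 2 + y ^+ 2 == (5 * n)%:Z, (5 %| x)%Z & (5 %| y)%Z].
Proof.
move=> nN; have n5N : (n %/ 5 <= N)%N by exact: leq_trans (leq_div _ _) nN.
apply/idP/and3P.
  case: ifP => // n5 /mapP[[a b]]; rewrite mem_two_squares //= => /eqP E [-> ->].
  by split; [apply/eqP; nia|lia|lia].
case=> /eqP E /dvdzP[a xa] /dvdzP[b yb].
have n5 : (5 %| n)%N by nia.
rewrite n5; apply/mapP; exists (a, b); last by rewrite /mul_5 /=; congr (_, _); lia.
by rewrite mem_two_squares //=; apply/eqP; nia.
Qed.

(** Inclusion-exclusion: x^2 + y^2 = 5n makes 5 divide (x - 2y)(x + 2y), so every such pair is a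
    multiple of 2 + i or of 2 - i, and of both exactly when it is a multiple of 5. *)
Lemma size_two_squares N n : (5 * n <= N)%N ->
  (size (two_squares N (5 * n)) +
     (if (5 %| n)%N then size (two_squares N (n %/ 5)) else 0) =
   2 * size (two_squares N n))%N.
Proof.
move=> nN; have nN' : (n <= N)%N by lia.
have -> : (if (5 %| n)%N then size (two_squares N (n %/ 5)) else 0%N) =
  size (if (5 %| n)%N then map mul_5 (two_squares N (n %/ 5)) else [::]).
  by case: ifP; rewrite ?size_map.
have -> : (2 * size (two_squares N n) = size (map mul_2pi (two_squares N n)) +
                                         size (map mul_2mi (two_squares N n)))%N.
  by rewrite !size_map; lia.
rewrite -!size_cat.
apply: perm_size; apply/allP => -[x y] _; apply/eqP; rewrite !count_cat !count_uniq_mem.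
- rewrite mem_mul_2pi // mem_mul_2mi // mem_mul_5 // mem_two_squares //=.
  case: (x ^+ 2 + y ^+ 2 =P (5 * n)%:Z) => //= E.
  have d12 : (5 %| x - 2 * y)%Z || (5 %| x + 2 * y)%Z.
    have : (5 %| (x - 2 * y) * (x + 2 * y))%Z.
      apply/dvdzP; exists (n%:Z - y ^+ 2).
      have -> : (x - 2 * y) * (x + 2 * y) = x ^+ 2 + y ^+ 2 - 5 * y ^+ 2 by ring.
      by rewrite E PoszM; ring.
    by rewrite !dvdzE abszM Euclid_dvdM.
  have -> : (5 %| x)%Z && (5 %| y)%Z = (5 %| x - 2 * y)%Z && (5 %| x + 2 * y)%Z.
    apply/andP/andP=> -[]; lia.
  by move: d12; do 2!case: (5 %| _)%Z.
- by rewrite map_inj_uniq ?two_squares_uniq // => -[a b] [c d] [*]; congr (_, _); lia.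
- by rewrite map_inj_uniq ?two_squares_uniq // => -[a b] [c d] [*]; congr (_, _); lia.
- case: ifP => // _.
  by rewrite map_inj_uniq ?two_squares_uniq // => -[a b] [c d] [*]; congr (_, _); lia.
exact: two_squares_uniq.
Qed.

Section ThetaSquare.
Variable R : comNzRingType.
Local Notation theta := (theta R).

(** All pairs carry the same sign, since z + w and z^2 + w^2 have the same parity. *)
Lemma theta_sqr_coef N n : (n <= N)%N ->
  (theta ^+ 2) n = (-1) ^+ n * (size (two_squares N n))%:R.
Proof.
move=> nN; rewrite (fps_eqmX 2 (@theta_eqm R N)) // expr2 big_distrl /=.
under eq_bigr => z _ do rewrite big_distrr /=.
rewrite fps_coef_sum; under eq_bigr => z _ do rewrite fps_coef_sum.
rewrite /two_squares size_filter -sum1_count natr_sum mulr_sumr [RHS]big_mkcond big_allpairs.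
apply: eq_bigr => z _; apply: eq_bigr => w _.
rewrite fps_monoM /fps_mono eq_sym [(z, w).1]/= [(z, w).2]/=.
case: eqP => // <-; rewrite mulr1 -exprD -[LHS]signr_odd -[RHS]signr_odd.
by rewrite !oddD !oddX.
Qed.

(** This is r_2(5n) + r_2(n/5) = 2 r_2(n); as 5 is odd, the signs at 5n, n and n/5 agree. *)
Lemma theta_sqr_sect :
  fps_sect 5 (theta ^+ 2) + fps_dil 5 theta ^+ 2 = theta ^+ 2 *+ 2.
Proof.
rewrite -fps_dilX //; apply/funext=> n; rewrite fps_coefD fps_coefMn /fps_sect /fps_dil.
have le5 : (n %/ 5 <= 5 * n)%N by lia.
rewrite !(theta_sqr_coef (N := 5 * n)) //; last by lia.
have sgn : (-1) ^+ (5 * n) = (-1) ^+ n :> R by rewrite -signr_odd oddM signr_odd.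
rewrite sgn -mulrnAr -mulrnA [(size _ * 2)%N]mulnC.
rewrite -(size_two_squares (N := 5 * n)) // natrD mulrDr.
congr (_ + _); case: ifP => [n5|]; last by rewrite mulr0.
by congr (_ * _); rewrite -[LHS]signr_odd -[RHS]signr_odd -{2}(divnK n5) oddM andbT.
Qed.

End ThetaSquare.

(** * The 5-dissection of powers of the theta series *)

Section Dissection.
Variable R : comNzRingType.
Implicit Types f g h : fps R.
Local Notation theta := (theta R).

Definition dil5 f : fps R := fps_dil 5 f.
Definition sect5 f : fps R := fps_sect 5 f.

Fact dil5_zmod_morphism : zmod_morphism dil5.
Proof.
move=> f g; apply/funext=> n; rewrite fps_coefD fps_coefN /dil5 /fps_dil.
by case: ifP; rewrite // subr0.
Qed.

Fact dil5_monoid_morphism : monoid_morphism dil5.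
Proof.
by split=> [|f g]; [apply: (fps_dil_mono 1 0)|apply: fps_dilM].
Qed.

Fact sect5_zmod_morphism : zmod_morphism sect5. Proof. by []. Qed.

HB.instance Definition _ :=
  GRing.isZmodMorphism.Build (fps R) (fps R) dil5 dil5_zmod_morphism.
HB.instance Definition _ :=
  GRing.isMonoidMorphism.Build (fps R) (fps R) dil5 dil5_monoid_morphism.
HB.instance Definition _ :=
  GRing.isZmodMorphism.Build (fps R) (fps R) sect5 sect5_zmod_morphism.

Lemma dil5K f : sect5 (dil5 f) = f. Proof. exact: fps_sect_dil. Qed.

Lemma sect5M f g : sect5 (dil5 g * f) = g * sect5 f.
Proof. exact: fps_sectM_dil. Qed.

Definition class5 r f : fps R := fun n => if (n %% 5 == r)%N then f n else 0.

Lemma class5P r f : (r < 5)%N -> fps_class 5 r (class5 r f).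
Proof.
move=> r5 n; rewrite /class5; case: (eqVneq (n %% 5)%N r) => [->|_]; last by rewrite eqxx.
by rewrite modn_small.
Qed.

Lemma fps_classX l r f p : fps_class l r f -> fps_class l (r * p) (f ^+ p).
Proof.
move=> fr; elim: p => [|p IH]; last by rewrite exprS mulnS; apply: fps_classM.
by move=> n; rewrite expr0 fps_coef1 muln0; case: (eqVneq n 0%N) => [->|_]; rewrite ?eqxx.
Qed.

Lemma theta_class n : theta n != 0 -> exists z : int, n = (absz z ^ 2)%N.
Proof.
have [/hasP[z _ /eqP zn]|/hasPn no] := boolP (has (fun z => n == absz z ^ 2)%N (zrange n)).
  by exists z.
rewrite /theta big_seq big1 ?eqxx // => z /no /negPf.
by rewrite /fps_mono => ->.
Qed.

(** Squares are 0, 1 or 4 mod 5. *)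
Lemma theta_split : theta = class5 0 theta + class5 1 theta + class5 4 theta.
Proof.
apply/funext=> n; rewrite !fps_coefD /class5.
have [->|/theta_class[z ->]] := eqVneq (theta n) 0; first by rewrite !if_same !addr0.
set k := (absz z ^ 2)%N.
have [->|[->|->]] : (k %% 5 = 0 \/ k %% 5 = 1 \/ k %% 5 = 4)%N; rewrite /= ?addr0 ?add0r //.
rewrite /k -modnXm; have : (absz z %% 5 < 5)%N by rewrite ltn_mod.
by case: (_ %% 5)%N => [|[|[|[|[|]]]]] // _;
  [left|right; left|right; right|right; right|right; left].
Qed.

(** If z^2 = 5n, then z = 5w and n = 5 w^2, and z has the parity of w. *)
Lemma theta_sect : sect5 theta = dil5 theta.
Proof.
apply/funext=> n; rewrite /sect5 /fps_sect (@thetaE R _ (5 * n)) //.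
pose F z : R := fps_mono ((-1) ^+ absz z) (absz z ^ 2) (5 * n).
have -> : \sum_(z <- zrange (5 * n)) F z = \sum_(w <- zrange n) F (5 * w).
  rewrite -(big_map (fun w => 5 * w) xpredT F) (bigID (fun z => 5 %| z)%Z) [LHS]/=.
  rewrite [X in _ + X]big1 ?addr0 => [|z /= nz]; last first.
    rewrite /F /fps_mono; case: eqP => // E; case/negP: nz.
    have : (5 %| absz z ^ 2)%N by rewrite -E dvdn_mulr.
    by rewrite Euclid_dvdX // => /andP[].
  rewrite -big_filter; apply: perm_big; apply: uniq_perm.
  - exact/filter_uniq/zrange_uniq.
  - by rewrite map_inj_uniq ?zrange_uniq // => a b; lia.
  move=> z; rewrite mem_filter mem_zrange; apply/andP/mapP => [[/dvdzP[w ->] wn]|[w]].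
    by exists w; rewrite ?mem_zrange; lia.
  by rewrite mem_zrange => wn ->; split; lia.
rewrite /dil5 /fps_dil; case: ifP => n5.
  rewrite (@thetaE R _ n); last exact: leq_div.
  apply: eq_bigr => w _; rewrite /F /fps_mono abszM.
  have -> : (5 * n == (5 * absz w) ^ 2)%N = (n %/ 5 == absz w ^ 2)%N by apply/eqP/eqP; nia.
  by rewrite -signr_odd oddM signr_odd.
apply: big1 => w _; rewrite /F /fps_mono abszM; case: eqP => // E.
case/negP: n5; rewrite -(@dvdn_pmul2l 5) // E expnMn; exact: dvdn_mulr.
Qed.

(** * Extraction from powers of a sum over the classes 0, 1 and 4 *)

Section Components.
Variables b c : fps R.
Hypotheses (b1 : fps_class 5 1 b) (c4 : fps_class 5 4 c).

(** For 0 < p < 5 the powers b^p and c^p lie in the classes p and 4p, neither of them 0 mod 5.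
    Powers of the full sum take this shape once bc is known to be a series in X^5. *)
Lemma sect5_graded h0 h1 h2 h3 h4 :
  sect5 (dil5 h0 + dil5 h1 * (b + c) + dil5 h2 * (b ^+ 2 + c ^+ 2)
       + dil5 h3 * (b ^+ 3 + c ^+ 3) + dil5 h4 * (b ^+ 4 + c ^+ 4)) = h0.
Proof.
have bX p : ~~ (5 %| p)%N -> sect5 (b ^+ p) = 0.
  by move=> p5; apply: (fps_class_sect0 _ (fps_classX (p := p) b1)); rewrite mul1n.
have cX p : ~~ (5 %| p)%N -> sect5 (c ^+ p) = 0.
  by move=> p5; apply: (fps_class_sect0 _ (fps_classX (p := p) c4)); rewrite Gauss_dvdr.
rewrite 4!raddfD /= dil5K !sect5M !raddfD /= !bX // !cX //.
by rewrite -[b]expr1 -[c]expr1 bX // cX // addr0 !mulr0 !addr0.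
Qed.

Lemma dil5_bc : dil5 (sect5 (b * c)) = b * c.
Proof.
apply: fps_class_dil_sect => n bc0.
by rewrite (fps_classM b1 c4 bc0).
Qed.

Lemma sect5_sqr A : let E := sect5 (b * c) in
  sect5 ((dil5 A + b + c) ^+ 2) = A ^+ 2 + 2 * E.
Proof.
move=> E; rewrite -[RHS](sect5_graded _ (2 * A) 1 0 0); congr sect5.
rewrite rmorphD rmorphM /= (_ : dil5 E = b * c) ?dil5_bc //; ring.
Qed.

Lemma sect5_cube A : let E := sect5 (b * c) in
  sect5 ((dil5 A + b + c) ^+ 3) = A ^+ 3 + 6 * (A * E).
Proof.
(* Each product bc is replaced by [dil5 E]: 3 b^2 c + 3 b c^2 adds 3 E to the coefficient [h1] of b
   + c, and the term with bc alone joins [h0]. *)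
move=> E; rewrite -[RHS](sect5_graded _ (3 * A ^+ 2 + 3 * E) (3 * A) 1 0); congr sect5.
rewrite !(rmorphD, rmorphM) /= (_ : dil5 E = b * c) ?dil5_bc //; ring.
Qed.

Lemma sect5_fourth A : let E := sect5 (b * c) in
  sect5 ((dil5 A + b + c) ^+ 4) = A ^+ 4 + 12 * (A ^+ 2 * E) + 6 * E ^+ 2.
Proof.
move=> E; rewrite -[RHS](sect5_graded _ (4 * A ^+ 3 + 12 * (A * E))
  (6 * A ^+ 2 + 4 * E) (4 * A) 1); congr sect5.
rewrite !(rmorphD, rmorphM, rmorphXn) /= (_ : dil5 E = b * c) ?dil5_bc //; ring.
Qed.

End Components.

Lemma theta_components : exists b c : fps R,
  [/\ fps_class 5 1 b, fps_class 5 4 c & theta = dil5 (dil5 theta) + b + c].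
Proof.
exists (class5 1 theta), (class5 4 theta); split; try exact: class5P.
rewrite {1}theta_split; congr (_ + _ + _); apply/funext=> n.
(* The class 0 part is V U th, and U th = V th. *)
rewrite -theta_sect /class5 /dil5 /sect5 /fps_dil /fps_sect /dvdn.
by case: ifP => // n5; rewrite mulnC divnK.
Qed.

End Dissection.

(** * Modulo 5 *)

Lemma fps_F5_5 : 5%:R = 0 :> fps 'F_5.
Proof.
apply/funext=> n; rewrite fps_coefMn -mulr_natr [5%:R](_ : _ = 0) ?mulr0 //.
exact/val_inj.
Qed.

(** Up to any given order f is a finite sum of monomials; the fifth power is additive in
    characteristic 5 and fixes the elements of F_5. *)
Lemma fps_F5_frobenius (f : fps 'F_5) : f ^+ 5 = dil5 f.
Proof.
have ch5 : 5%N \in [pchar (fps 'F_5)] by apply/andP; split=> //; rewrite fps_F5_5.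
apply: fps_eqmP => N; pose g : fps 'F_5 := \sum_(i < N) fps_mono (f i) i.
have fg : fps_eqm N f g.
  move=> n nN; rewrite /g fps_coef_sum (bigD1 (Ordinal nN)) //= /fps_mono eqxx.
  rewrite big1 ?addr0 // => i; rewrite -val_eqE /= eq_sym.
  by case: eqP.
apply: fps_eqm_trans (fps_eqmX 5 fg) _.
have -> : g ^+ 5 = dil5 g.
  rewrite -(pFrobenius_autE ch5) !rmorph_sum /=; apply: eq_bigr => i _.
  rewrite pFrobenius_autE fps_monoX /dil5 fps_dil_mono // mulnC.
  congr fps_mono; case: (f i) => [[|[|[|[|[|k]]]]] k5] //; exact/val_inj.
by apply: fps_eqm_sym; apply: (fps_eqm_dil _ _ fg) => //; lia.
Qed.

Local Notation th := (theta 'F_5).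

Lemma theta_F5_sections :
  [/\ sect5 (th ^+ 2) = 2 * th ^+ 2 - dil5 th ^+ 2,
      sect5 (th ^+ 3) = dil5 th * th ^+ 2 &
      sect5 (th ^+ 4) = th ^+ 4].
Proof.
have S2 : sect5 (th ^+ 2) = 2 * th ^+ 2 - dil5 th ^+ 2.
  by rewrite mulr_natl -theta_sqr_sect addrK.
have [b [c [b1 c4 thE]]] := theta_components 'F_5.
set A := dil5 th in S2 thE *; set E := sect5 (b * c).
(* The two values of U(th^2), A^2 + 2 E and 2 th^2 - A^2, are compared; 2 is then inverted as 3,
   since 6 = 1 mod 5. *)
have EE : E = th ^+ 2 - A ^+ 2.
  have H : 2 * E = 2 * (th ^+ 2 - A ^+ 2).
    have := sect5_sqr b1 c4 A; rewrite -thE S2 => H.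
    by rewrite -[2 * E](addrK (A ^+ 2)) [2 * E + _]addrC -H; ring.
  have -> : E = 3 * (2 * E) - 5 * E by ring.
  rewrite H fps_F5_5 mul0r subr0 mulrA.
  have -> : 3 * 2 = 1 + 5%:R :> fps 'F_5 by ring.
  by rewrite fps_F5_5 addr0 mul1r.
split=> //.
  rewrite [in LHS]thE (sect5_cube b1 c4) -/E EE.
  have -> : A ^+ 3 + 6 * (A * (th ^+ 2 - A ^+ 2)) =
            A * th ^+ 2 + 5 * (A * th ^+ 2 - A ^+ 3) by ring.
  by rewrite fps_F5_5 mul0r addr0.
rewrite [in LHS]thE (sect5_fourth b1 c4) -/E EE.
(* The mixed terms A^2 th^2 cancel exactly, leaving 6 th^4 - 5 A^4. *)
have -> : A ^+ 4 + 12 * (A ^+ 2 * (th ^+ 2 - A ^+ 2)) + 6 * (th ^+ 2 - A ^+ 2) ^+ 2 =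
          th ^+ 4 + 5 * (th ^+ 4 - A ^+ 4) by ring.
by rewrite fps_F5_5 mul0r addr0.
Qed.

(** * Iterated extraction from the generating functions for powers of 5 *)

Definition overA_fps alpha : fps 'F_5 := fun n => (overA (5 ^ alpha) n)%:R.

Definition theta_dil alpha : fps 'F_5 := fps_dil (5 ^ alpha) th.

Lemma dil5_theta_dil alpha : dil5 (theta_dil alpha) = theta_dil alpha.+1.
Proof. by rewrite /dil5 fps_dil_comp ?expn_gt0 // -expnS. Qed.

(** Multiplied by th, the left side becomes U(V th * G) = U(th^4 * th G), where th G = V^(alpha+1)
    th leaves U as V^alpha th and U(th^4) = th^4. *)
Lemma overA_fps_sect alpha :
  sect5 (overA_fps alpha.+1) = theta_dil alpha * th ^+ 3.
Proof.
have [_ _ S4] := theta_F5_sections.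
apply: (@fps_cancel _ th); first exact: theta0.
rewrite -sect5M -fps_F5_frobenius [th ^+ 5]exprSr -mulrA.
rewrite /overA_fps overA_theta ?expn_gt0 // -/(theta_dil alpha.+1) -dil5_theta_dil.
by rewrite mulrC sect5M S4; ring.
Qed.

Lemma overA_fps_sect2 alpha :
  sect5 (sect5 (overA_fps alpha.+2)) = theta_dil alpha * (dil5 th * th ^+ 2).
Proof.
have [_ S3 _] := theta_F5_sections.
by rewrite overA_fps_sect -dil5_theta_dil sect5M S3.
Qed.

Lemma overA_fps_sect4 alpha :
  sect5 (sect5 (sect5 (sect5 (overA_fps alpha.+4)))) = sect5 (sect5 (overA_fps alpha.+2)).
Proof.
have [S2 S3 _] := theta_F5_sections.
rewrite !overA_fps_sect2 -!dil5_theta_dil !sect5M S2.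
(* The last U turns this into 2 V th * th^2 - th^2 * U th, which is V th * th^2 because U th = V
   th. *)
have -> : th * (2 * th ^+ 2 - dil5 th ^+ 2) = th ^+ 3 + th ^+ 3 - dil5 (th ^+ 2) * th.
  by rewrite rmorphXn /=; ring.
by rewrite raddfB raddfD /= sect5M S3 theta_sect; ring.
Qed.

Local Close Scope ring_scope.
Theorem theorem10 (n alpha : nat) (halpha : 2 <= alpha) :
  overA (5 ^ alpha) (25 * n) = overA (5 ^ (alpha + 2)) (625 * n) %[mod 5].
Proof.
case: alpha halpha => [|[|alpha]] // _; rewrite !addSn addn2.
(* At coefficient n, two applications of U read index 25n and four read index 625n. *)
have := congr1 (fun f : fps 'F_5 => nat_of_ord (f n)) (overA_fps_sect4 alpha).
by rewrite /sect5 /fps_sect /overA_fps !mulnA /= !val_Fp_nat.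
Qed.
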